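(* (1) $\operatorname{Aut}(Y_{1,3})\cong D_4\times C_2$. (2) For all integers $n\ge1$ and $m\ge0$ with $m\neq2$ and $(n,m)\neq(1,3)$, $\operatorname{Aut}(Y_{n,m})\cong A_{n,m}$, where $A_{n,m}=\langle\varphi,\psi,\tau\rangle\le\operatorname{Aut}(Y_{n,m})$.
   Context: For integers $n\ge1$, $m\ge0$, the Yoke graph $Y_{n,m}$ has vertices the tuples $v=(v_0,\dots,v_{m+1})$ with $v_0,v_{m+1}\in\mathbb{Z}_n$, $v_1,\dots,v_m\in\{0,1\}$, $\sum v_i\equiv0\pmod n$; $u\sim v$ iff there is $0\le i\le m$ with $u_j=v_j$ for $j\notin\{i,i+1\}$ and either ($u_i=v_i+1$, $u_{i+1}=v_{i+1}-1$) or ($u_i=v_i-1$, $u_{i+1}=v_{i+1}+1$), bucket entries computed mod $n$. Define (bucket entries mod $n$): $\varphi(v_0,v_1,\dots,v_m,v_{m+1})=(v_0+1,v_1,\dots,v_m,v_{m+1}-1)$; $\psi(v_0,\dots,v_{m+1})=(v_{m+1},v_m,\dots,v_1,v_0)$; $\tau(v_0,v_1,\dots,v_m,v_{m+1})=(-v_0,1-v_1,\dots,1-v_m,-(m+v_{m+1}))$; these are automorphisms of $Y_{n,m}$ and $A_{n,m}$ is the subgroup they generate. $C_2$ is cyclic of order 2 and $D_4$ is the dihedral group of order 8. *)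

(* Defs.v *)
From HB Require Import structures.
From mathcomp Require Import all_boot all_fingroup all_algebra all_solvable.

Set Implicit Arguments.
Unset Strict Implicit.
Unset Printing Implicit Defensive.

(* A "raw" vertex is a triple (v_0, (v_1,...,v_m), v_{m+1}) with      *)
(* v_0, v_{m+1} in Z_n (represented by 'I_n, arithmetic mod n) and    *)
(* v_1..v_m booleans (0/1).  A vertex is a raw vertex with            *)
(* sum v_i = 0 mod n.                                                  *)

Definition yraw (n m : nat) := ('I_n * m.-tuple bool * 'I_n)%type.

Definition yoke_vert n m (x : yraw n m) : bool :=
  (x.1.1 + count id x.1.2 + x.2) %% n == 0.

Definition yoke_vertex n m := {x : yraw n m | yoke_vert x}.

Lemma ord_pos n (i : 'I_n) : 0 < n.
Proof. exact: leq_ltn_trans (leq0n i) (ltn_ord i). Qed.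

Definition zshift n (i : 'I_n) (k : nat) : 'I_n :=
  Ordinal (ltn_pmod (i + k) (ord_pos i)).

Definition zoppshift n (i : 'I_n) (k : nat) : 'I_n :=
  Ordinal (ltn_pmod (n - (i + k) %% n) (ord_pos i)).

Definition ycoord n m (x : yraw n m) (j : nat) : nat :=
  if j == 0 then nat_of_ord x.1.1
  else if j == m.+1 then nat_of_ord x.2
  else nat_of_bool (nth false x.1.2 j.-1).

Definition ybucket m (j : nat) : bool := (j == 0) || (j == m.+1).

Definition ysucc n m (j a b : nat) : bool :=
  if ybucket m j then a == (b + 1) %% n else a == b + 1.

(* u_i = v_i + 1 and u_{i+1} = v_{i+1} - 1  (i.e. v_{i+1} = u_{i+1} + 1) *)
Definition ymove n m (u v : yraw n m) (i : nat) : bool :=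
  ysucc n m i (ycoord u i) (ycoord v i) &&
  ysucc n m i.+1 (ycoord v i.+1) (ycoord u i.+1).

Definition yoke_adj n m (u v : yoke_vertex n m) : bool :=
  [exists i : 'I_m.+1,
     [forall j : 'I_m.+2,
        ((j : nat) != i) && ((j : nat) != i.+1) ==>
        (ycoord (val u) j == ycoord (val v) j)]
     && (ymove (val u) (val v) i || ymove (val v) (val u) i)].

Definition yoke_aut n m : {set {perm yoke_vertex n m}} :=
  [set f : {perm yoke_vertex n m} |
     [forall u, forall v, yoke_adj (f u) (f v) == yoke_adj u v]].

Definition yphi n m (x : yraw n m) : yraw n m :=
  (zshift x.1.1 1, x.1.2, zshift x.2 (n - 1)).

Definition ypsi n m (x : yraw n m) : yraw n m :=
  (x.2, rev_tuple x.1.2, x.1.1).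

Definition ytau n m (x : yraw n m) : yraw n m :=
  (zoppshift x.1.1 0, map_tuple negb x.1.2, zoppshift x.2 m).

Definition yoke_A n m : {set {perm yoke_vertex n m}} :=
  <<[set f : {perm yoke_vertex n m} |
       [forall v, val (f v) == yphi (val v)]
    || [forall v, val (f v) == ypsi (val v)]
    || [forall v, val (f v) == ytau (val v)]]>>%g.

(* Main.v *)
(* For m >= 1 a vertex is a residue v_0 together with m bits, and an edge is a
   move [i] with 0 <= i <= m that flips the bits i and i+1, where the bits 0 and
   m+1 are absent; the moves 0 and m are always possible, an inner move needs
   distinct bits.  The degree is thus 2 plus the number of bit changes, so an
   automorphism sends z = (0; 0...0) to a vertex with constant bits, and an
   element of A brings it back to z; psi exchanges the two neighbours of z, so
   it is enough to show that an automorphism fixing z and its neighbours is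
   trivial.
   Suppose that v and its neighbours are fixed and let w be obtained from v by
   the move i.  A neighbour of w by a move k not adjacent to i closes a square
   on v, and is fixed because two opposite corners of a square have no other
   common neighbour; this is where (1,3) and m = 2 are excluded.  Only the
   moves i-1 and i+1 remain, so all the neighbours of w are fixed, unless both
   of these are possible and lead to vertices of the same degree.  For m = 1
   and m > 3 the bits can be filled in from the left without meeting that
   situation; for m = 3 an explicit path visits all the vertices.  For m = 0
   the graph is a cycle, and for (1,3) a backtracking search bounds the order
   of the automorphism group by 16. *)

Require Import Defs.
From HB Require Import structures.
From mathcomp Require Import all_boot all_fingroup all_algebra all_solvable.
From mathcomp Require Import zify.

Set Implicit Arguments.
Unset Strict Implicit.
Unset Printing Implicit Defensive.

(** * The automorphisms phi, psi and tau *)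

Section Yoke.
Variables n m : nat.
Hypothesis n_gt0 : 0 < n.
Local Notation T := (yoke_vertex n m).

Lemma succ_modE a : a < n -> (a + 1) %% n = if a.+1 == n then 0 else a.+1.
Proof.
move=> an; rewrite addn1; case: eqP => [->|ne]; first by rewrite modnn.
by rewrite modn_small //; lia.
Qed.

Lemma pred_modE a : a < n -> (a + (n - 1)) %% n = if a == 0 then n.-1 else a.-1.
Proof.
move=> an; case: eqP => [->|ne]; first by rewrite add0n modn_small; lia.
have -> : a + (n - 1) = n + a.-1 by lia.
by rewrite modnDl modn_small //; lia.
Qed.

Lemma opp_modE a : a < n -> (n - a) %% n = if a == 0 then 0 else n - a.
Proof.
move=> an; case: eqP => [->|ne]; first by rewrite subn0 modnn.
by rewrite modn_small //; lia.
Qed.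

Lemma yoke_vertE (x : yraw n m) :
  yoke_vert x = (n %| x.1.1 + count id x.1.2 + x.2).
Proof. by []. Qed.

Lemma yphi_vert (v : T) : yoke_vert (yphi (val v)).
Proof.
rewrite yoke_vertE; case: v => [[[a t] c]] /=; rewrite yoke_vertE /= => h.
rewrite /dvdn; have -> : ((a + 1) %% n + count id t + (c + (n - 1)) %% n) %% n
  = (a + count id t + c + n) %% n.
  rewrite -modnDmr modn_mod modnDmr -addnA modnDml; congr (_ %% _); lia.
by rewrite modnDr.
Qed.

Lemma ypsi_vert (v : T) : yoke_vert (ypsi (val v)).
Proof.
rewrite yoke_vertE; case: v => [[[a t] c]] /=; rewrite yoke_vertE /=.
by rewrite count_rev; congr (_ %| _); lia.
Qed.

Lemma dvdn_opp_mod x : n %| (n - x %% n) %% n + x.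
Proof.
rewrite /dvdn modnDml -modnDmr subnK ?modnn //.
by rewrite ltnW // ltn_mod.
Qed.

(** The entries of [v] and of its image together give [-a + a] for the first bucket, [m] for the
    complementary bits and [-(m + c) + c] for the last bucket: a multiple of [n]. *)
Lemma ytau_vert (v : T) : yoke_vert (ytau (val v)).
Proof.
rewrite yoke_vertE; case: v => [[[a t] c]] /=; rewrite yoke_vertE /= => h.
have hc : count id (map negb t) + count id t = m.
  by rewrite count_map addnC -{3}(size_tuple t) -(count_predC id t).
have := dvdn_add (dvdn_opp_mod (a + 0)) (dvdn_opp_mod (c + m)).
move=> e; rewrite -(dvdn_addl _ h); apply: etrans e; congr (_ %| _).
by move: (_ %% n) (_ %% n) => X Y; lia.
Qed.

Definition vphi (v : T) : T := exist _ (yphi (val v)) (yphi_vert v).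
Definition vpsi (v : T) : T := exist _ (ypsi (val v)) (ypsi_vert v).
Definition vtau (v : T) : T := exist _ (ytau (val v)) (ytau_vert v).

Lemma vphi_inj : injective vphi.
Proof.
move=> [[[a t] c] hv] [[[a' t'] c'] hv'] /(congr1 val) /= [ea et ec].
apply: val_inj => /=.
have -> : a = a'.
  apply: val_inj; move: ea; rewrite !succ_modE ?ltn_ord //=.
  by have := ltn_ord a; have := ltn_ord a'; do 2!case: eqP; lia.
have -> : c = c'.
  apply: val_inj; move: ec; rewrite !pred_modE ?ltn_ord //=.
  by have := ltn_ord c; have := ltn_ord c'; do 2!case: eqP; lia.
by rewrite et.
Qed.

Lemma vpsiK : involutive vpsi.
Proof.
move=> [[[a t] c] hv]; apply: val_inj => /=; congr (_, _, _).
by apply: val_inj; rewrite /= revK.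
Qed.

(** Both sides are below [n] and opposite to [y + k] modulo [n], where [y] is the inner image. *)
Lemma opp_mod_twice x k : x < n ->
  (n - ((n - (x + k) %% n) %% n + k) %% n) %% n = x.
Proof.
move=> xn; set y := (n - (x + k) %% n) %% n.
have h1 : n %| y + (x + k) by exact: dvdn_opp_mod.
have h2 : n %| (n - (y + k) %% n) %% n + (y + k) by exact: dvdn_opp_mod.
rewrite -[RHS](modn_small xn) -[LHS]modn_mod; apply/eqP.
rewrite -(eqn_modDr (y + k)) (eqP h2).
by rewrite (_ : x + (y + k) = y + (x + k)) ?(eqP h1) //; lia.
Qed.

Lemma vtauK : involutive vtau.
Proof.
move=> [[[a t] c] hv]; apply: val_inj => /=.
congr (_, _, _); apply: val_inj => /=.
- exact: opp_mod_twice.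
- by rewrite -map_comp -[RHS]map_id; apply: eq_map => b /=; rewrite negbK.
exact: opp_mod_twice.
Qed.

Definition pphi : {perm T} := perm vphi_inj.
Definition ppsi : {perm T} := perm (inv_inj vpsiK).
Definition ptau : {perm T} := perm (inv_inj vtauK).

Lemma pphi_A : pphi \in yoke_A n m.
Proof.
apply: mem_gen; rewrite inE; apply/orP; left; apply/orP; left.
by apply/forallP => v; rewrite permE.
Qed.

Lemma ppsi_A : ppsi \in yoke_A n m.
Proof.
apply: mem_gen; rewrite inE; apply/orP; left; apply/orP; right.
by apply/forallP => v; rewrite permE.
Qed.

Lemma ptau_A : ptau \in yoke_A n m.
Proof.
apply: mem_gen; rewrite inE; apply/orP; right.
by apply/forallP => v; rewrite permE.
Qed.

Lemma yoke_autP (f : {perm T}) :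
  reflect (forall u v, yoke_adj (f u) (f v) = yoke_adj u v)
          (f \in yoke_aut n m).
Proof.
rewrite inE; apply: (iffP forallP) => [h u v|h u].
  by move/forallP: (h u) => /(_ v) /eqP.
by apply/forallP => v; rewrite h.
Qed.

Lemma yoke_aut_group_set : group_set (yoke_aut n m).
Proof.
apply/group_setP; split; first by apply/yoke_autP => u v; rewrite !perm1.
move=> f g /yoke_autP hf /yoke_autP hg; apply/yoke_autP => u v.
by rewrite !permM hg hf.
Qed.
Canonical yoke_aut_group := Group yoke_aut_group_set.

(* A finite-order permutation reflects whatever its powers preserve. *)
Lemma homo_yoke_aut (f : {perm T}) :
  (forall u v, yoke_adj u v -> yoke_adj (f u) (f v)) -> f \in yoke_aut n m.
Proof.
move=> h; apply/yoke_autP => u v; apply/idP/idP; last exact: h.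
have hX k a b : yoke_adj a b -> yoke_adj ((f ^+ k)%g a) ((f ^+ k)%g b).
  elim: k => [|k IH] hab; rewrite ?perm1 // expgSr !permM.
  exact/h/IH.
by move=> /(hX #[f].-1%g); rewrite -invg_expg !permK.
Qed.

(** * Permutations acting entry by entry *)

Definition ybound j a := if ybucket m j then a < n else a < 2.

Lemma ycoord_bound (u : yraw n m) j : ybound j (ycoord u j).
Proof.
rewrite /ybound /ycoord /ybucket; case: eqP => _ /=; first exact: ltn_ord.
by case: eqP => _; [exact: ltn_ord | case: nth].
Qed.

Section CoordinateMap.
Variables (F : {perm T}) (g : nat -> nat -> nat).
Hypothesis Fg : forall v j, j <= m.+1 ->
  ycoord (val (F v)) j = g j (ycoord (val v) j).

Lemma coordinate_map_eq u v i :
  [forall j : 'I_m.+2, ((j : nat) != i) && ((j : nat) != i.+1) ==>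
    (ycoord (val u) j == ycoord (val v) j)] ->
  [forall j : 'I_m.+2, ((j : nat) != i) && ((j : nat) != i.+1) ==>
    (ycoord (val (F u)) j == ycoord (val (F v)) j)].
Proof.
move=> /forallP h; apply/forallP => k; apply/implyP => hk.
by move: (h k); rewrite hk !Fg -1?ltnS //= => /eqP ->.
Qed.

Lemma coordinate_map_aut :
  (forall j a b, ybound j a -> ybound j b -> ysucc n m j a b ->
     ysucc n m j (g j a) (g j b)) -> F \in yoke_aut n m.
Proof.
move=> hg; apply: homo_yoke_aut => u v /existsP[i /andP[h1 h2]].
apply/existsP; exists i; rewrite (coordinate_map_eq h1) /=.
have lei : i <= m by rewrite -ltnS.
by case/orP: h2 => /andP[ha hb]; apply/orP; [left | right];
  rewrite /ymove !Fg ?(leqW lei) // !hg ?ycoord_bound.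
Qed.

(** Reversing the successor relation in every entry exchanges the two orientations of a move, and
    adjacency allows both. *)
Lemma coordinate_antimap_aut :
  (forall j a b, ybound j a -> ybound j b -> ysucc n m j a b ->
     ysucc n m j (g j b) (g j a)) -> F \in yoke_aut n m.
Proof.
move=> hg; apply: homo_yoke_aut => u v /existsP[i /andP[h1 h2]].
apply/existsP; exists i; rewrite (coordinate_map_eq h1) /=.
have lei : i <= m by rewrite -ltnS.
by case/orP: h2 => /andP[ha hb]; apply/orP; [right | left];
  rewrite /ymove !Fg ?(leqW lei) // !hg ?ycoord_bound.
Qed.
End CoordinateMap.

Lemma pphi_aut : pphi \in yoke_aut n m.
Proof.
apply: (coordinate_map_aut (g := fun j a => if j == 0 then (a + 1) %% n else
  if j == m.+1 then (a + (n - 1)) %% n else a)).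
  by move=> v j _; rewrite permE /ycoord /=; do 2!case: eqP => //.
move=> j a b; rewrite /ybound /ysucc /ybucket.
case: (j == 0) => /=; last case: (j == m.+1) => //=.
  by move=> _ _ /eqP ->.
move=> an bn /eqP ->.
rewrite succ_modE // !pred_modE //; last by case: eqP; lia.
by rewrite succ_modE; do ![case: eqP => /=]; lia.
Qed.

Lemma ptau_aut : ptau \in yoke_aut n m.
Proof.
apply: (coordinate_antimap_aut (g := fun j a =>
  if j == 0 then (n - (a + 0) %% n) %% n else
  if j == m.+1 then (n - (a + m) %% n) %% n else 1 - a)).
  move=> v j jm; rewrite permE /ycoord /=; case: eqP => // j0.
  case: eqP => // jm1; rewrite (nth_map false) ?size_tuple; last lia.
  by case: nth.
move=> j a b; rewrite /ybound /ysucc /ybucket.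
(* Negation after a shift reverses the successor relation; the shift is 0 in the first bucket and
   [m] in the last. *)
have key x y k : x < n -> y < n -> x = (y + 1) %% n ->
    (n - (y + k) %% n) %% n = ((n - (x + k) %% n) %% n + 1) %% n.
  move=> xn yn ->.
  rewrite (modnDml (y + 1) k) (_ : y + 1 + k = y + k + 1); last lia.
  rewrite -(modnDml (y + k) 1).
  have : (y + k) %% n < n by rewrite ltn_mod.
  move: ((y + k) %% n) => d dn.
  rewrite (succ_modE dn) opp_modE // opp_modE; last by case: eqP; lia.
  by rewrite succ_modE; do ![case: eqP => /=]; lia.
case: (j == 0) => /=; last case: (j == m.+1) => //=.
- by move=> an bn /eqP e; rewrite (key _ _ _ an bn e).
- by move=> an bn /eqP e; rewrite (key _ _ _ an bn e).
by move=> an bn /eqP e; apply/eqP; lia.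
Qed.

(** Reversal permutes the positions, so the entrywise criteria do not apply: the move [i] becomes
    the move [m - i], with the opposite orientation. *)
Lemma ppsi_aut : ppsi \in yoke_aut n m.
Proof.
have hc v j : j <= m.+1 ->
    ycoord (val (ppsi v)) j = ycoord (val v) (m.+1 - j).
  move=> jm; rewrite permE /ycoord /=.
  have [->|j0] := eqVneq j 0; first by rewrite subn0 /= eqxx.
  have [->|j1] := eqVneq j m.+1; first by rewrite subnn.
  rewrite !ifF; try lia; rewrite nth_rev size_tuple; last lia.
  by congr (nat_of_bool (nth _ _ _)); lia.
have hs j a b : j <= m.+1 -> ysucc n m (m.+1 - j) a b = ysucc n m j a b.
  by move=> jm; rewrite /ysucc /ybucket; congr (if _ then _ else _); lia.
apply: homo_yoke_aut => u v /existsP[i /andP[/forallP h1 h2]].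
have lei : i <= m by rewrite -ltnS.
apply/existsP; exists (rev_ord i); apply/andP; split.
  apply/forallP => j; apply/implyP => /= hj.
  have := h1 (rev_ord j); rewrite !hc -1?ltnS //= subSS.
  move/implyP => /(_ _)/eqP ->; rewrite ?eqxx //.
  by have := ltn_ord j; have := ltn_ord i; move: hj => /=; lia.
have hm a b : ymove (val a) (val b) i ->
    ymove (val (ppsi b)) (val (ppsi a)) (rev_ord i).
  move=> /andP[ha hb].
  have r1 : rev_ord i <= m.+1 by rewrite /=; lia.
  have r2 : (rev_ord i).+1 <= m.+1 by rewrite /=; lia.
  rewrite /ymove !hc //=.
  rewrite !subSS; apply/andP; split.
    have e : m.+1 - (m - i) = i.+1 by lia.
    by rewrite e -(hs (m - i)) ?e //; lia.
  have e : m - (m - i) = i by lia.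
  by rewrite e -(hs (m - i).+1) ?subSS ?e //; lia.
by apply/orP; case/orP: h2 => /hm h; [right | left].
Qed.

Lemma yoke_A_sub : yoke_A n m \subset yoke_aut n m.
Proof.
rewrite gen_subG; apply/subsetP => f; rewrite inE -orbA.
case/or3P => /forallP h; [have -> : f = pphi | have -> : f = ppsi |
  have -> : f = ptau]; rewrite ?pphi_aut ?ppsi_aut ?ptau_aut //;
  by apply/permP => v; apply: val_inj; rewrite permE (eqP (h v)).
Qed.

(** * Coordinates and moves *)

Definition hd (v : T) : 'I_n := (val v).1.1.
Definition tl (v : T) : 'I_n := (val v).2.
Definition bit (v : T) (j : nat) : bool := nth false (val v).1.2 j.-1.

Lemma ycoord0 (v : T) : ycoord (val v) 0 = hd v.
Proof. by []. Qed.

Lemma ycoord_last (v : T) : ycoord (val v) m.+1 = tl v.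
Proof. by rewrite /ycoord eqxx. Qed.

Lemma ycoord_bit (v : T) j : 0 < j <= m -> ycoord (val v) j = bit v j.
Proof. by move=> hj; rewrite /ycoord !ifF //; lia. Qed.

(** By the vertex condition this is opposite to [tl v] modulo [n]; the last bucket is always
    computed through it. *)
Definition level (v : T) := \sum_(j < m.+1) ycoord (val v) j.

Lemma levelE (v : T) : level v = hd v + count id (val v).1.2.
Proof.
rewrite /level big_ord_recl; congr (_ + _).
rewrite -sum1_count [RHS]big_mkcond (big_nth false) size_tuple big_mkord.
by apply: eq_bigr => j _; rewrite lift0 ycoord_bit ?ltn_ord.
Qed.

Lemma level_dvd (v : T) : n %| level v + tl v.
Proof. by rewrite levelE; have := valP v. Qed.

Lemma tl_unique (v : T) c : c < n -> n %| level v + c -> tl v = c :> nat.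
Proof.
move=> cn h; have h' := level_dvd v.
rewrite -(modn_small cn) -(modn_small (ltn_ord (tl v))); apply/eqP.
by rewrite -(eqn_modDl (level v)) (eqP h) (eqP h').
Qed.

Lemma vertex_ext (u v : T) : hd u = hd v ->
  (forall j, 0 < j <= m -> bit u j = bit v j) -> u = v.
Proof.
move=> ha hb; have et : (val u).1.2 = (val v).1.2.
  apply: eq_from_tnth => j; rewrite !(tnth_nth false).
  by have := hb j.+1; rewrite ltn_ord; apply.
have ec : tl u = tl v.
  apply: val_inj; apply: tl_unique; first exact: ltn_ord.
  by rewrite levelE ha et -levelE level_dvd.
apply: val_inj; move: ha et ec; rewrite /hd /tl.
by case: (val u) => [[a t] c]; case: (val v) => [[a' t'] c'] /= -> -> ->.
Qed.

Fact make_vertex_proof (a : 'I_n) (b : nat -> bool) :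
  yoke_vert (a, [tuple b k.+1 | k < m],
             zoppshift a (count id [tuple b k.+1 | k < m])).
Proof.
by rewrite yoke_vertE /= addnC; apply: dvdn_opp_mod.
Qed.

(** Only the values of [b] at 1, ..., [m] count; the last bucket is solved from the vertex
    condition. *)
Definition make_vertex a b : T :=
  exist (fun x => yoke_vert x) _ (make_vertex_proof a b).

Arguments make_vertex : simpl never.

Lemma bit_make a b j : 0 < j <= m -> bit (make_vertex a b) j = b j.
Proof.
case: j => // j jm; rewrite /bit /= (nth_map (Ordinal jm)) ?size_enum_ord //.
by rewrite nth_enum_ord.
Qed.

(** A bucket after the flip of the adjacent bit, of old value [b]: it gains what the bit loses. *)
Definition step (b : bool) (a : 'I_n) := zshift a (if b then 1 else n - 1).

Lemma stepK b : cancel (step b) (step (~~ b)).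
Proof.
move=> a; apply: val_inj => /=; have an := ltn_ord a; case: b => /=.
  by rewrite succ_modE // pred_modE; do ?case: ifP => /=; lia.
by rewrite pred_modE // succ_modE; do ?case: ifP => /=; lia.
Qed.

Lemma succ_step_false a : (step false a + 1) %% n = a.
Proof. exact: (congr1 val (stepK false a)). Qed.

Lemma step_trueE a : step true a = (a + 1) %% n :> nat.
Proof. by []. Qed.

Arguments step : simpl never.

Definition zero_vertex := make_vertex (Ordinal n_gt0) (fun _ => false).

Lemma bit_zero j : 0 < j <= m -> bit zero_vertex j = false.
Proof. exact: bit_make. Qed.

Lemma tl_zero : tl zero_vertex = 0 :> nat.
Proof.
apply: tl_unique => //; rewrite addn0 /level big1 // => -[[|j] jm] _ //.
by rewrite ycoord_bit ?bit_zero.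
Qed.

Lemma bit_psi v j : 0 < j <= m -> bit (ppsi v) j = bit v (m.+1 - j).
Proof.
move=> hj; rewrite permE /bit /= nth_rev size_tuple; last lia.
by congr nth; lia.
Qed.

Lemma psi_zero : ppsi zero_vertex = zero_vertex.
Proof.
apply: vertex_ext => [|j hj]; last by rewrite bit_psi // !bit_zero //; lia.
have -> : hd (ppsi zero_vertex) = tl zero_vertex by rewrite permE.
exact/val_inj/(etrans tl_zero).
Qed.

(** Powers of [pphi] bring the first bucket to 0 without touching the bits. *)
Lemma zero_of_bits u : (forall j, 0 < j <= m -> bit u j = false) ->
  exists2 g, g \in yoke_A n m & g u = zero_vertex.
Proof.
move: {2}(hd u : nat) (erefl (hd u : nat)) => k; elim: k u => [|k IH] u hk hb.
  exists 1%g; first exact: group1.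
  rewrite perm1; apply: vertex_ext => [|j hj]; last by rewrite hb ?bit_zero.
  exact/val_inj/hk.
pose u' := (pphi^-1)%g u; have eu : pphi u' = u by rewrite permKV.
have bu j : 0 < j <= m -> bit u' j = false.
  by move/hb; rewrite -{1}eu permE.
have hu : hd u' = k :> nat.
  have := hk; rewrite -{1}eu permE /= succ_modE ?ltn_ord //.
  by case: ifP => // _ [].
have [g gA gu] := IH u' hu bu; exists (pphi^-1 * g)%g; last by rewrite permM.
by rewrite groupM ?groupV ?pphi_A.
Qed.

(** The invariant that is carried from a vertex to its neighbours; fixing [v] alone would not
    propagate. *)
Definition fixed_near (f : {perm T}) (v : T) :=
  f v = v /\ forall u, yoke_adj u v -> f u = u.

(** The two neighbours are either fixed or exchanged by [f], and [ppsi] undoes the exchange. They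
    may coincide. *)
Lemma fixed_near_psi (f : {perm T}) p q : f \in yoke_aut n m ->
    f zero_vertex = zero_vertex -> ppsi p = q ->
    (forall u, yoke_adj u zero_vertex <-> u = p \/ u = q) ->
  exists2 g, g \in yoke_A n m & fixed_near (f * g)%g zero_vertex.
Proof.
move=> /yoke_autP hf fz pq hN.
have qp : ppsi q = p by rewrite -pq !permE vpsiK.
have fN u : yoke_adj u zero_vertex -> f u = p \/ f u = q.
  by move=> h; apply/hN; rewrite -fz hf.
have fp : f p = p \/ f p = q by apply/fN/hN; left.
have fq : f q = p \/ f q = q by apply/fN/hN; right.
have [pp|/eqP npp] := eqVneq (f p) p.
  have qq : f q = q.
    by case: fq => // e; rewrite e; apply: (@perm_inj _ f); rewrite e.
  exists 1%g; first exact: group1.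
  by split=> [|u /hN[]->]; rewrite mulg1.
have fpq : f p = q by case: fp.
have fqp : f q = p.
  case: fq => // e; case: npp; rewrite fpq.
  by apply: (@perm_inj _ f); rewrite e.
exists ppsi; first exact: ppsi_A.
by split=> [|u /hN[]->]; rewrite permM ?fz ?psi_zero ?fpq ?fqp ?qp ?pq.
Qed.

(** The reduction common to [m = 0] and [m > 0]: correcting [f] by two elements of [A] makes it
    trivial by rigidity, so [f] is the inverse of their product. *)
Lemma fixed_near_zeroP (f : {perm T}) :
    (forall h, h \in yoke_aut n m -> fixed_near h zero_vertex -> h = 1%g) ->
    (exists2 g, g \in yoke_A n m & (f * g)%g zero_vertex = zero_vertex) ->
    (exists p, forall u, yoke_adj u zero_vertex <-> u = p \/ u = ppsi p) ->
  f \in yoke_aut n m -> f \in yoke_A n m.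
Proof.
move=> rigid [g gA gz] [p hN] hf; have subA := subsetP yoke_A_sub.
have fg : (f * g)%g \in yoke_aut n m by apply: groupM => //; apply: subA.
have [h hA fh] := fixed_near_psi fg gz erefl hN.
have /rigid/(_ fh) e : (f * g * h)%g \in yoke_aut n m.
  by apply: groupM => //; apply: subA.
have -> : f = ((g * h)^-1)%g by apply/eqP; rewrite eq_mulgV1 invgK mulgA e.
by rewrite groupV groupM.
Qed.

(** * Moves as flips of two consecutive bits *)

Section Moves.
Hypothesis m_gt0 : 0 < m.

(** [bit v 0] and [bit v m.+1] are meaningless values; the first two disjuncts make the comparison
    irrelevant there. *)
Definition movable (v : T) i := [|| i == 0, i == m | bit v i != bit v i.+1].

(** Defined for impossible moves too, so that moves are sums of flips. Flips at the positions 0 and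
    [m.+1] are ignored, and the last bucket adjusts itself through [make_vertex]. *)
Definition mv (v : T) i : T :=
  make_vertex (if i == 0 then step (bit v 1) (hd v) else hd v)
    (fun j => bit v j (+) (j == i) (+) (j == i.+1)).

Arguments mv : simpl never.

Lemma hd_mv v i : hd (mv v i) = if i == 0 then step (bit v 1) (hd v) else hd v.
Proof. by []. Qed.

Lemma bit_mv v i j : 0 < j <= m ->
  bit (mv v i) j = bit v j (+) (j == i) (+) (j == i.+1).
Proof. exact: bit_make. Qed.

Lemma mvK v i : i <= m -> mv (mv v i) i = v.
Proof.
move=> im; apply: vertex_ext => [|j hj]; last first.
  by rewrite !bit_mv //; case: bit; do 2!case: eqP.
rewrite !hd_mv bit_mv ?m_gt0 //; case: eqP => // ->.
by rewrite /= addbF addbT stepK.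
Qed.

Lemma movable_mv v i : i <= m -> movable (mv v i) i = movable v i.
Proof.
move=> im; rewrite /movable; case: eqP => //= i0; case: eqP => //= im'.
by rewrite !bit_mv; lia.
Qed.

Lemma ycoord_mv v i j : j <= m -> j != i -> j != i.+1 ->
  ycoord (val (mv v i)) j = ycoord (val v) j.
Proof.
case: j => [|j] jm ji ji1; first by rewrite !ycoord0 hd_mv eq_sym (negbTE ji).
by rewrite !ycoord_bit // bit_mv // (negbTE ji) (negbTE ji1) !addbF.
Qed.

(** Both changed entries are counted in [level] and their changes cancel, only modulo [n] when
    [i = 0] since the first bucket may wrap around. *)
Lemma tl_mv_inner v i : i < m -> movable v i -> tl (mv v i) = tl v.
Proof.
move=> im mi; apply: val_inj; apply: tl_unique; first exact: ltn_ord.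
have i1 : i < m.+1 by lia.
have i2 : i.+1 < m.+1 by lia.
have hs u : level u = ycoord (val u) i + ycoord (val u) i.+1 +
    \sum_(j < m.+1 | (j != Ordinal i1) && (j != Ordinal i2)) ycoord (val u) j.
  by rewrite /level (bigD1 (Ordinal i1)) // (bigD1 (Ordinal i2)) /= ?addnA //;
    apply/eqP => /(congr1 val) /=; lia.
have := level_dvd v; rewrite !hs.
rewrite (eq_bigr (fun j : 'I_m.+1 => ycoord (val (mv v i)) j)); last first.
  by move=> j /andP[ji ji1]; rewrite ycoord_mv // -ltnS.
move: (\sum_(_ < _ | _) _) => X.
have e : ycoord (val (mv v i)) i + ycoord (val (mv v i)) i.+1 =
         ycoord (val v) i + ycoord (val v) i.+1 %[mod n].
  rewrite !(@ycoord_bit _ i.+1) // bit_mv // eqxx.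
  case: (posnP i) mi => [-> _|i0]; last first.
    rewrite /movable !ycoord_bit ?bit_mv ?i0 1?ltnW // eqxx.
    have -> : (i == m) = false by lia.
    have -> : (i == 0) = false by lia.
    have -> : (i == i.+1) = false by lia.
    have -> : (i.+1 == i) = false by lia.
    by move=> /=; do 2!case: bit.
  rewrite !ycoord0 hd_mv /= addbF; case: bit => /=.
    by rewrite addn0 modn_mod.
  by rewrite modnDml addn0 -addnA subnK // modnDr.
rewrite /dvdn -!addnA !(addnA (ycoord _ i)) => /eqP h.
by rewrite -modnDml e modnDml h.
Qed.

Lemma level_mv_last v : level (mv v m) + bit v m = level v + ~~ bit v m.
Proof.
have hs u : level u = bit u m + \sum_(j < m.+1 | j != ord_max) ycoord (val u) j.
  by rewrite /level (bigD1 ord_max) //= ycoord_bit // m_gt0 /=.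
rewrite !hs (eq_bigr (fun j : 'I_m.+1 => ycoord (val v) j)); last first.
  move=> j jm; rewrite ycoord_mv -1?ltnS //.
  by have := ltn_ord j; lia.
rewrite bit_mv ?m_gt0 /= // eqxx.
have -> : (m == m.+1) = false by lia.
by case: bit => /=; lia.
Qed.

Lemma tl_mv_last v : tl (mv v m) = step (bit v m) (tl v).
Proof.
apply: val_inj; apply: tl_unique; first exact: ltn_ord.
have := level_mv_last v; have := level_dvd v; rewrite /= /dvdn modnDmr.
case: bit => /= h e.
  by rewrite [X in X %% n](_ : _ = level v + tl v) //; lia.
rewrite [X in X %% n](_ : _ = level v + tl v + n); last lia.
by rewrite modnDr.
Qed.

Lemma adj_mv v i : i <= m -> movable v i -> yoke_adj (mv v i) v.
Proof.
move=> im mi; apply/existsP; exists (Ordinal (im : i < m.+1)).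
apply/andP; split.
  apply/forallP => j; apply/implyP => /andP[ji ji1].
  have := ltn_ord j; rewrite ltnS leq_eqVlt => /orP[/eqP ej|jm]; last first.
    by rewrite ycoord_mv // -ltnS.
  by rewrite ej !ycoord_last tl_mv_inner //; move: ji1; rewrite ej /=; lia.
have hi : ymove (val (mv v i)) (val v) i || ymove (val v) (val (mv v i)) i.
  rewrite /ymove /ysucc /ybucket eqSS.
  have [i0|i0] := posnP i.
    move: mi im; rewrite i0 => _ _.
    rewrite !ycoord0 hd_mv eqxx; have -> : (0 == m) = false by lia.
    rewrite !ycoord_bit ?bit_mv ?m_gt0 //=.
    by case: bit => //=; rewrite ?succ_step_false ?step_trueE ?eqxx ?orbT.
  have [em|nm] := eqVneq i m; last first.
    have -> : (i == m.+1) = false by lia.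
    move: mi; rewrite /movable !ycoord_bit ?bit_mv; try lia.
    by rewrite (negbTE nm) orbF; lia.
  rewrite em !ycoord_last tl_mv_last !ycoord_bit ?bit_mv ?m_gt0 ?leqnn // eqxx.
  have f1 : (m == 0) = false by lia.
  have f2 : (m == m.+1) = false by lia.
  rewrite ?f1 ?f2 ?orbF ?orbT ?addbF ?addbT.
  by case: bit => //=; rewrite ?succ_step_false ?step_trueE ?eqxx ?orbT.
exact: hi.
Qed.

(** The bits of [v] decide which orientation of the move [i] can occur, so [v] and [i] determine the
    neighbour. *)
Lemma adjP (u v : T) :
  reflect (exists i, [/\ i <= m, movable v i & u = mv v i]) (yoke_adj u v).
Proof.
apply: (iffP idP) => [|[i [im mi ->]]]; last exact: adj_mv.
case/existsP => -[i im] /= /andP[/forallP h1 h2].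
exists i; split; first by rewrite -ltnS.
  rewrite /movable; have [//|i0] := posnP i; have [//|nm] := eqVneq i m.
  move: h2; rewrite /ymove /ysucc /ybucket eqSS (negbTE nm).
  have -> : (i == 0) = false by lia.
  have -> : (i == m.+1) = false by lia.
  by rewrite /= !ycoord_bit; try lia; do 4!case: bit.
have h1' j : j <= m -> j != i -> j != i.+1 ->
    ycoord (val u) j = ycoord (val v) j.
  move=> jm ji ji1; have jm2 : j < m.+2 by lia.
  by have := h1 (Ordinal jm2); rewrite /= ji ji1 /= => /eqP.
have hd0 : i = 0 -> hd u = step (bit v 1) (hd v) /\ bit u 1 = ~~ bit v 1.
  move=> i0; move: h2; rewrite i0 /ymove /ysucc /ybucket /= eqSS.
  have -> : (0 == m) = false by lia.
  rewrite !ycoord0 !ycoord_bit ?m_gt0 //.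
  case: (bit u 1); case: (bit v 1);
    rewrite ?andbF ?orbF //= ?andbT => /eqP e.
    split=> //; rewrite -[hd u](stepK true) /=; congr (step _ _).
    exact: val_inj.
  by split=> //; apply: val_inj.
apply: vertex_ext => [|j hj].
  rewrite hd_mv; case: eqP => [/hd0[]//|i0].
  by apply: val_inj; rewrite /= -!ycoord0 h1' //; lia.
rewrite bit_mv //; have [ej|ji] := eqVneq j i.
  have -> : (j == i.+1) = false by lia.
  subst i; have nb : ybucket m j = false by rewrite /ybucket; lia.
  move: h2; rewrite /ymove /ysucc nb !(ycoord_bit _ hj).
  by case: (bit u j); case: (bit v j).
have [ej|ji1] := eqVneq j i.+1; last first.
  have /andP[_ jm] := hj; have := h1' j jm ji ji1.
  by rewrite !ycoord_bit //; lia.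
rewrite addbF addbT; subst j; have [i0|i0] := posnP i.
  by subst i; case: (hd0 erefl).
move: h2; rewrite /ymove /ysucc /ybucket eqSS.
have -> : (i == 0) = false by lia.
have -> : (i == m) = false by lia.
have -> : (i == m.+1) = false by lia.
by rewrite !ycoord_bit; try lia; do 4!case: bit.
Qed.

(** * Rigidity for m > 0 *)

(** The bit [x.+1] is flipped exactly by the moves [x] and [x.+1]. Hence [x] and [x.+1] occur with
    the same parity among the four moves, and this parity is constant from 0 to [m]. *)
Lemma flips_const i k j l :
  (forall x, 0 < x <= m ->
     (x == i) (+) (x == i.+1) (+) (x == k) (+) (x == k.+1) =
     (x == j) (+) (x == j.+1) (+) (x == l) (+) (x == l.+1)) ->
  forall x, x <= m ->
    (x == i) (+) (x == k) (+) (x == j) (+) (x == l) =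
    (0 == i) (+) (0 == k) (+) (0 == j) (+) (0 == l).
Proof.
move=> h; elim=> [//|x IH] xm; rewrite -(IH (ltnW xm)); clear IH.
have := h x.+1 xm; rewrite !eqSS.
move: (x == i) (x == k) (x == j) (x == l).
move: (x.+1 == i) (x.+1 == k) (x.+1 == j) (x.+1 == l).
by do 8!case.
Qed.

Lemma mv_inj (v : T) i k :
  1 < m -> i <= m -> k <= m -> mv v i = mv v k -> i = k.
Proof.
move=> m1 im km e.
(* The move 0 is added on both sides to fit [flips_const]; its two occurrences cancel. If [i] and
   [k] differ, each position up to [m] is one of them, which fails for 0, 1, 2. *)
have h x : 0 < x <= m ->
    (x == i) (+) (x == i.+1) (+) (x == 0) (+) (x == 1) =
    (x == k) (+) (x == k.+1) (+) (x == 0) (+) (x == 1).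
  move=> hx; have := congr1 (fun u => bit u x) e; rewrite !bit_mv //.
  by move: (x == i) (x == k) => a b; case: bit a b => -[] -[];
    case: (x == i.+1); case: (x == k.+1).
have c := flips_const h.
have [//|ik] := eqVneq i k.
have d x : x <= m -> x = i \/ x = k.
  move=> xm; have := etrans (c x xm) (esym (c i im)); rewrite eqxx (negbTE ik).
  case: eqP; first by left.
  by case: (x =P k) => [|_ _]; [right | case: (x == 0); case: (i == 0)].
by have := d 0 (leq0n m); have := d 1 m_gt0; have := d 2 m1; lia.
Qed.

Lemma step_neq b (a : 'I_n) : 1 < n -> step b a != a.
Proof.
move=> n1; apply/eqP => /(congr1 val); rewrite /step /=; have := ltn_ord a.
by case: b => an; rewrite ?succ_modE ?pred_modE //; case: ifP; lia.
Qed.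

(** Two paths of length two from [v] to the same vertex: the second move of one either goes back to
    [v] or is the first move of the other. *)
Lemma common_neighbours (v : T) i j k l :
    (3 < m) || ((m == 3) && (1 < n)) ->
    i <= m -> j <= m -> k <= m -> l <= m -> i != j ->
    mv (mv v i) k = mv (mv v j) l ->
  k = i \/ k = j.
Proof.
move=> hm im jm km lm ij e.
have m1 : 1 < m by lia.
have [->|ki] := eqVneq k i; first by left.
have lj : l != j.
  apply/eqP => lj; move/eqP: ki; apply; apply: (mv_inj m1 km im (v := mv v i)).
  by rewrite e lj !mvK.
have h x : 0 < x <= m ->
    (x == i) (+) (x == i.+1) (+) (x == k) (+) (x == k.+1) =
    (x == j) (+) (x == j.+1) (+) (x == l) (+) (x == l.+1).
  move=> hx; have := congr1 (fun u => bit u x) e; rewrite !bit_mv //.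
  by rewrite -!addbA => /addbI.
have c := flips_const h.
(* Even parity: [j] must occur a second time among the four moves, and only [k] is left for that. *)
case c0: ((0 == i) (+) (0 == k) (+) (0 == j) (+) (0 == l)); last first.
  right; have := c j jm; rewrite c0 eqxx.
  rewrite [j == l]eq_sym (negbTE lj) [j == i]eq_sym (negbTE ij).
  by case: eqP.
(* Odd parity: all positions up to [m] occur among four moves, which forces [m = 3] and so
   [1 < n]. *)
have sub : {subset iota 0 m.+1 <= [:: i; k; j; l]}.
  move=> x; rewrite mem_iota /= ltnS => xm; have := c x xm; rewrite c0 !inE.
  by do 4!case: (x == _).
have := uniq_leq_size (iota_uniq _ _) sub; rewrite size_iota /= => m3.
have n1 : 1 < n by lia.
have e0 := congr1 (fun u => hd u) e; rewrite /= !hd_mv in e0.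
have s1 b a : step b a <> a :> 'I_n by apply/eqP; apply: step_neq.
have s2 b a : a <> step b a :> 'I_n by move/esym; apply: s1.
(* An odd number of the four moves are 0, and exactly one because [k != i] and [l != j]. The first
   bucket then changes on one side only. *)
move: c0 ki lj e0; rewrite ![0 == _]eq_sym.
case: (i =P 0) => i0; case: (k =P 0) => k0; case: (j =P 0) => j0;
case: (l =P 0) => l0 //= _ ki lj; first [lia | by move/s1 | by move/s2].
Qed.

Lemma movable_far (v : T) i k : k != i -> k.+1 != i -> k != i.+1 -> k <= m ->
  movable (mv v i) k = movable v k.
Proof.
move=> ki k1i ki1 km; rewrite /movable.
case: eqP => //= k0; case: eqP => //= k1.
by rewrite !bit_mv; lia.
Qed.

Lemma mv_comm (v : T) i k : k != i -> k.+1 != i -> k != i.+1 ->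
  mv (mv v i) k = mv (mv v k) i.
Proof.
move=> ki k1i ki1; apply: vertex_ext => [|j hj].
  rewrite !hd_mv !bit_mv ?m_gt0 //.
  by move: ki k1i ki1; case: i => [|[|i]]; case: k => [|[|k]] //=;
    rewrite ?addbF.
rewrite !bit_mv //; move: (j == i) (j == i.+1) (j == k) (j == k.+1) => a b c d.
by rewrite -!addbA; congr (_ (+) _); move: a b c d; do 4!case.
Qed.

(** * Degrees and propagation along a move *)

Definition degree (v : T) := #|[set u | yoke_adj u v]|.

Lemma degree_aut (f : {perm T}) v :
  f \in yoke_aut n m -> degree (f v) = degree v.
Proof.
move/yoke_autP => hf; rewrite /degree -[RHS](card_imset _ (@perm_inj _ f)).
apply: eq_card => u; rewrite inE; apply/idP/imsetP => [h|[x]].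
  by exists ((f^-1)%g u); rewrite ?permKV // inE -hf permKV.
by rewrite inE => h ->; rewrite hf.
Qed.

(** The last hypothesis prevents [f] from exchanging the two neighbours of [mv v i] reached by the
    moves [i.-1] and [i.+1]; all the others are fixed by the square argument. *)
Lemma fixed_near_step (f : {perm T}) v i :
    (m == 1) || (3 < m) || ((m == 3) && (1 < n)) ->
    f \in yoke_aut n m -> fixed_near f v -> i <= m -> movable v i ->
    (0 < i < m -> movable (mv v i) i.-1 -> movable (mv v i) i.+1 ->
       degree (mv (mv v i) i.-1) != degree (mv (mv v i) i.+1)) ->
  fixed_near f (mv v i).
Proof.
(* A move at distance at least 2 from [i] requires [m >= 2], which discards [m = 1]. *)
move=> hm; have farm k : i <= m -> k <= m -> k != i -> k.+1 != i -> k != i.+1 ->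
    (3 < m) || (m == 3) && (1 < n) by lia.
move=> hf [fv fN] im mi hdeg; set w := mv v i.
have /yoke_autP adjf := hf.
have fw : f w = w by apply: fN; apply: adj_mv.
have fmv k : k <= m -> movable w k ->
    exists k', [/\ k' <= m, movable w k' & f (mv w k) = mv w k'].
  by move=> km mk; apply/adjP => //; rewrite -{2}fw adjf adj_mv.
have far k : k <= m -> movable w k -> k.+1 != i -> k != i.+1 ->
    f (mv w k) = mv w k.
  move=> km mk k1i ki1; have [->|ki] := eqVneq k i; first by rewrite mvK.
  have [k' [k'm mk' e]] := fmv k km mk.
  have mvk : movable v k by rewrite -(movable_far v ki k1i ki1).
  (* The image is adjacent to both [w] and [mv v k], which are fixed; their only common neighbours
     are [v] and [mv w k]. *)
  have : yoke_adj (f (mv w k)) (mv v k).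
    rewrite -(fN (mv v k)) ?adj_mv // adjf mv_comm // adj_mv //.
    by rewrite movable_far // 1?eq_sym.
  case/adjP => // l [lm ml]; rewrite e => e'.
  have ik : i != k by rewrite eq_sym.
  have hm' := farm k im km ki k1i ki1.
  have [k'i|-> //] := common_neighbours hm' im km k'm lm ik e'.
  have e2 : f (mv w k) = f v by rewrite e k'i mvK.
  have e3 := perm_inj e2; case/eqP: ki; apply: (@mv_inj w) => //.
    by case/orP: hm' => [/ltnW/ltnW // | /andP[/eqP-> _]].
  by rewrite e3 mvK.
split=> // u /adjP[] // k [km mk ->].
have [k' [k'm mk' e]] := fmv k km mk.
have [fk'|nfk'] := eqVneq (f (mv w k')) (mv w k').
  by rewrite e; apply: (@perm_inj _ f); rewrite e.
have near q : q <= m -> movable w q -> f (mv w q) != mv w q ->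
    q.+1 = i \/ q = i.+1.
  move=> qm mq fq; have [|q1] := eqVneq q.+1 i; first by left.
  have [|qi1] := eqVneq q i.+1; first by right.
  by rewrite far ?eqxx in fq.
have nk' := near k' k'm mk' nfk'.
have [-> //|nfk] := eqVneq (f (mv w k)) (mv w k).
have nk := near k km mk nfk.
have kk' : k != k' by apply: contra_neq nfk => {2}->.
have dk : degree (mv w k) = degree (mv w k') by rewrite -e degree_aut.
(* If neither [mv w k] nor [mv w k'] is fixed, [k] and [k'] are [i.-1] and [i.+1] in some order, and
   equal degrees contradict [hdeg]. *)
have absurd q q' : q.+1 = i -> q' = i.+1 -> q' <= m -> movable w q ->
    movable w q' -> degree (mv w q) = degree (mv w q') -> False.
  move=> hq hq' q'm mq mq' dq; have qi : q = i.-1 by rewrite -hq.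
  rewrite {}hq' {}qi in q'm mq mq' dq.
  have im' : 0 < i < m by rewrite -{1}hq.
  by have := hdeg im' mq mq'; rewrite -/w dq eqxx.
case: nk => hk; case: nk' => hk'.
- by case/eqP: kk'; apply: succn_inj; rewrite hk.
- by case: (absurd k k').
- by case: (absurd k' k).
by case/eqP: kk'; rewrite hk.
Qed.

Lemma degreeE v : 1 < m -> degree v = #|[set i : 'I_m.+1 | movable v i]|.
Proof.
move=> m1; rewrite /degree -(@card_in_imset _ _ (fun i : 'I_m.+1 => mv v i)).
  apply: eq_card => u; rewrite inE; apply/adjP/imsetP => //.
    by case=> i [im mi ->]; exists (inord i); rewrite ?inE inordK.
  by case=> i; rewrite inE => mi ->; exists i; split=> //; rewrite -ltnS.
move=> i j _ _ /mv_inj e; apply: val_inj; apply: e => //; by rewrite -ltnS.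
Qed.

Lemma degree_neq u v i : 1 < m -> i <= m ->
  movable u i != movable v i ->
  (forall j, j <= m -> j != i -> movable u j = movable v j) ->
  degree u != degree v.
Proof.
move=> m1 im hi hj; rewrite !degreeE //.
rewrite (cardsD1 (inord i)) [X in _ != X](cardsD1 (inord i)).
have -> : [set k : 'I_m.+1 | movable u k] :\ inord i =
          [set k : 'I_m.+1 | movable v k] :\ inord i.
  apply/setP => k; rewrite !inE; case: eqP => //= ki; apply: hj.
    by rewrite -ltnS.
  by apply/eqP => e; apply: ki; rewrite -e inord_val.
by rewrite eqn_add2r !inE inordK //; move: hi; do 2!case: movable.
Qed.

Lemma bit_mv_lt (v : T) i j :
  0 < j -> j <= m -> j < i -> bit (mv v i) j = bit v j.
Proof.
move=> j0 jm ji; rewrite bit_mv ?j0 // (ltn_eqF ji) (ltn_eqF (leqW ji)).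
by rewrite !addbF.
Qed.

(* If bit s+1 of w is q, then the bits s+1, ..., s+4 become q100 and q011: the
   degrees differ because the move s+1 is possible in exactly one of the two. *)
Lemma corner_degree (w : T) s : s.+4 = m -> bit w s.+2 = false ->
    bit w s.+3 = true -> bit w s.+4 = false ->
  degree (mv w s.+2) != degree (mv w s.+4).
Proof.
move=> em w1 w2 w3; have m1 : 1 < m by rewrite -em.
have le j : j <= s.+4 -> j <= m by rewrite em.
have E j : (j == j.+1) = false by apply: ltn_eqF.
have E2 j : (j == j.+2) = false by apply: ltn_eqF; apply: leqW.
have u1 : bit (mv w s.+2) s.+2 = true.
  by rewrite bit_mv ?w1 ?eqxx ?E // le // leqW.
have u2 : bit (mv w s.+2) s.+3 = false.
  by rewrite bit_mv ?w2 ?eqxx ?[s.+3 == _]eq_sym ?E // le // leqW.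
have u3 : bit (mv w s.+2) s.+4 = false.
  by rewrite bit_mv ?w3 ?[s.+4 == _]eq_sym ?E2 ?E // le.
have u'1 : bit (mv w s.+4) s.+2 = false by rewrite bit_mv_lt // le // leqW.
have u'2 : bit (mv w s.+4) s.+3 = true by rewrite bit_mv_lt // le // leqW.
have u'3 : bit (mv w s.+4) s.+4 = true.
  by rewrite bit_mv ?w3 ?eqxx ?E // le.
have low j i : 0 < j -> j < s.+2 -> s.+2 <= i -> bit (mv w i) j = bit w j.
  move=> j0 js si; apply: bit_mv_lt => //; last exact: leq_trans si.
  by apply: le; apply: ltnW; do 2!apply: leqW.
have l24 : s.+2 <= s.+4 by do 2!apply: leqW.
apply: (@degree_neq _ _ s.+1) => //.
- by apply: le; rewrite leqW // leqW.
- have sm : s.+1 < m by rewrite -em; do 2!apply: leqW.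
  have mvs v : movable v s.+1 = (bit v s.+1 != bit v s.+2).
    by rewrite /movable (ltn_eqF sm).
  by rewrite !mvs u1 u'1 !low //; case: bit.
move=> j jm js; rewrite /movable; case: eqP => //= j0.
case: (j =P m) => //= jm'.
have [->|j2] := eqVneq j s.+2; first by rewrite u1 u2 u'1 u'2.
have [->|j3] := eqVneq j s.+3; first by rewrite u2 u3 u'2 u'3.
have j0' : 0 < j by case: (j) j0.
have js' : j < s.+1.
  rewrite ltn_neqAle js -ltnS ltn_neqAle j2 -ltnS ltn_neqAle j3 -ltnS.
  by rewrite ltn_neqAle em jm andbT; apply/eqP.
by rewrite !low // leqW.
Qed.

(** When the last [k] bits of [v] are 0, they can be filled arbitrarily. To put a 1 at the leftmost
    of them, it is first placed one position further right, which the induction allows, and then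
    moved left. *)
Lemma spread (f : {perm T}) k v u :
    (m == 1) || (3 < m) -> f \in yoke_aut n m -> fixed_near f v -> k <= m ->
    (forall j, m - k < j <= m -> bit v j = false) ->
    hd u = hd v -> (forall j, 0 < j <= m - k -> bit u j = bit v j) ->
  fixed_near f u.
Proof.
move=> hm hf; elim: k v u => [|k IH] v u fv km zv hu bu.
  suff -> : u = v by [].
  by apply: vertex_ext => // j; rewrite -{1}(subn0 m) => /bu.
set r := m - k; have r0 : 0 < r by rewrite subn_gt0.
have rm : r <= m by rewrite leq_subr.
have er : m - k.+1 = r.-1 by rewrite subnS.
rewrite er in zv bu.
have zv' j : r < j <= m -> bit v j = false.
  by move=> hj; apply: zv; lia.
have vr : bit v r = false by apply: zv; lia.
case ur: (bit u r); last first.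
  apply: (IH v) => //; first exact: ltnW.
  move=> j hj; have [->|jr] := eqVneq j r; first by rewrite ur.
  by apply: bu; rewrite -/r in hj; lia.
(* [w] has its last 1 at [r]; the move [r] pushes this 1 to [r.+1], or into the last bucket when
   [r = m]. *)
pose w := make_vertex (hd v) (fun j => ((j < r) && bit v j) || (j == r)).
have bw j : 0 < j <= m -> bit w j = ((j < r) && bit v j) || (j == r).
  exact: bit_make.
suff gw : fixed_near f w.
  apply: (IH w) => //; first exact: ltnW.
    by move=> j hj; rewrite bw; rewrite -/r in hj; lia.
  move=> j hj; rewrite -/r in hj; rewrite bw; last lia.
  have [->|jr] := eqVneq j r; first by rewrite orbT ur.
  have jr' : j < r by lia.
  have -> : bit u j = bit v j by apply: bu; lia.
  by rewrite jr'; case: bit.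
have wr : bit w r by rewrite bw ?r0 // eqxx orbT.
have wr0 j : r < j <= m -> bit w j = false by move=> hj; rewrite bw; lia.
have mw : movable w r.
  rewrite /movable; have [->|rm'] := eqVneq r m; first by rewrite orbT.
  by rewrite wr wr0 ?orbT //; lia.
rewrite -(mvK w rm); apply: fixed_near_step => //.
- by rewrite hm.
- apply: (IH v) => //; first exact: ltnW.
    by rewrite hd_mv; case: eqP => // r00; rewrite r00 in r0.
  move=> j hj; rewrite -/r in hj; rewrite bit_mv ?bw; try lia.
  have [->|jr] := eqVneq j r; first by rewrite vr ltnn; lia.
  by case: (bit v j); lia.
- by rewrite movable_mv.
rewrite mvK // => rm' m1 m2.
(* The bits of [w] beyond [r] are 0, so the move [r.+1] is possible only as the extreme move [m]. *)
have er1 : r.+1 = m.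
  apply/eqP; move: m2; rewrite /movable /=; case: eqP => // ne.
  by rewrite !wr0 //; lia.
have m3 : 3 < m.
  by case/orP: hm => // /eqP m1'; move: er1 r0; rewrite m1' => -[->].
have e3 : (r - 3).+3 = r by rewrite -addn3 subnK // -ltnS er1.
have e2 : (r - 3).+2 = r.-1 by rewrite -[in RHS]e3.
(* Here [s = r - 3] because [s.+4 = m = r.+1]. The move [r.-1] is possible, so the bits [r.-1], [r],
   [r.+1] are 010. *)
have := @corner_degree w (r - 3); rewrite e3 e2; apply=> //.
  have rm1 : r.-1 < m by apply: leq_ltn_trans (leq_pred r) _; rewrite -er1.
  move: m1; rewrite /movable -e2 /= e2 (ltn_eqF rm1) prednK // wr /=.
  by case: bit.
by apply: wr0; rewrite er1 leqnn.
Qed.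

(** For an extreme move the degree condition is void. *)
Lemma fixed_near_step_end (f : {perm T}) v i :
    (m == 1) || (3 < m) || ((m == 3) && (1 < n)) ->
    f \in yoke_aut n m -> fixed_near f v -> (i == 0) || (i == m) ->
  fixed_near f (mv v i).
Proof.
move=> hm hf fv hi; apply: fixed_near_step => //; first lia.
  by rewrite /movable orbA hi.
by move=> h; lia.
Qed.

Lemma rigid_generic (f : {perm T}) :
    (m == 1) || (3 < m) -> f \in yoke_aut n m -> fixed_near f zero_vertex ->
  f = 1%g.
Proof.
move=> hm hf fz.
suff all_fixed k v : hd v = k :> nat -> fixed_near f v.
  by apply/permP => v; rewrite perm1; case: (all_fixed _ v erefl).
elim: k v => [|k IH] v hv.
  apply: (@spread _ m zero_vertex) => //; rewrite ?subnn.
  - by move=> j; apply: bit_zero.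
  - exact: val_inj.
  by case.
have kn : k < n by rewrite ltnW // -hv.
(* From [(k; 10...0)] the move 0 leads to [(k+1; 0...0)], where [spread] starts again. *)
pose v0 := make_vertex (Ordinal kn) (fun j => j == 1).
have f0 : fixed_near f (mv v0 0).
  by apply: fixed_near_step_end => //; [rewrite hm | apply: IH].
apply: (@spread _ m (mv v0 0)) => //; rewrite ?subnn.
- by move=> j hj; rewrite bit_mv // bit_make //; lia.
- have -> : hd (mv v0 0) = step true (Ordinal kn).
    by rewrite hd_mv bit_make ?m_gt0.
  apply: val_inj; apply: (etrans hv).
  by rewrite /step /= succ_modE // ltn_eqF // -hv.
by case.
Qed.

(** * Rigidity for m = 3 *)

Section Three.
Hypothesis m3 : m = 3.

Definition mk3 a b1 b2 b3 :=
  make_vertex a (fun j => nth false [:: b1; b2; b3] j.-1).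

Lemma bit3_ext u v : hd u = hd v -> bit u 1 = bit v 1 -> bit u 2 = bit v 2 ->
  bit u 3 = bit v 3 -> u = v.
Proof.
move=> h0 h1 h2 h3; apply: vertex_ext => // j; rewrite m3.
by case: j => [|[|[|[|j]]]].
Qed.

Lemma mk3E v : v = mk3 (hd v) (bit v 1) (bit v 2) (bit v 3).
Proof. by apply: bit3_ext => //; rewrite bit_make // m3. Qed.

Lemma mv3 a b1 b2 b3 : let v := mk3 a b1 b2 b3 in
  [/\ mv v 0 = mk3 (step b1 a) (~~ b1) b2 b3, mv v 1 = mk3 a (~~ b1) (~~ b2) b3,
      mv v 2 = mk3 a b1 (~~ b2) (~~ b3) & mv v 3 = mk3 a b1 b2 (~~ b3)].
Proof.
by move=> v; split; apply: bit3_ext; rewrite ?hd_mv ?bit_mv ?bit_make ?m3 //=;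
  rewrite ?addbT ?addbF.
Qed.

(** A path from [(a; 000)] to the eight vertices with first bucket [a - 1], along which the degree
    condition is always void. *)
Lemma fixed_near3_up (f : {perm T}) a : 1 < n -> f \in yoke_aut n m ->
    fixed_near f (mk3 a false false false) ->
  forall v, hd v = step false a -> fixed_near f v.
Proof.
move=> n1 hf fa.
have hm : (m == 1) || (3 < m) || ((m == 3) && (1 < n)) by rewrite m3 n1.
have s0 a' b1 b2 b3 : fixed_near f (mk3 a' b1 b2 b3) ->
    fixed_near f (mk3 (step b1 a') (~~ b1) b2 b3).
  have [<- _ _ _] := mv3 a' b1 b2 b3.
  by move=> h; apply: fixed_near_step_end.
have s3 a' b1 b2 b3 : fixed_near f (mk3 a' b1 b2 b3) ->
    fixed_near f (mk3 a' b1 b2 (~~ b3)).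
  have [_ _ _ <-] := mv3 a' b1 b2 b3.
  by move=> h; apply: fixed_near_step_end => //; rewrite m3.
(* After this move the bits 2 and 3 agree, so the move 2 is impossible. In [s2] the bits 1 and 2
   agree and the move 1 is impossible. *)
have s1 a' b : fixed_near f (mk3 a' b (~~ b) b) ->
    fixed_near f (mk3 a' (~~ b) b b).
  have [_ e _ _] := mv3 a' b (~~ b) b; rewrite negbK in e; rewrite -e => h.
  apply: fixed_near_step => //.
    by rewrite /movable !bit_make ?m3 //=; case: (b).
  by move=> _ _; rewrite e /movable !bit_make ?m3 //= eqxx.
have s2 a' b : fixed_near f (mk3 a' b (~~ b) b) ->
    fixed_near f (mk3 a' b b (~~ b)).
  have [_ _ e _] := mv3 a' b (~~ b) b; rewrite negbK in e; rewrite -e => h.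
  apply: fixed_near_step => //; first by rewrite m3.
    by rewrite /movable !bit_make ?m3 //=; case: (b).
  by move=> _ + _; rewrite e /movable !bit_make ?m3 //= eqxx.
set a1 := step false a.
(* From 000 through 001; the move 0 turns the first bit on and lowers the bucket. *)
have f101 : fixed_near f (mk3 a1 true false true) := s0 _ _ _ _ (s3 _ _ _ _ fa).
have f011 : fixed_near f (mk3 a1 false true true) := s1 _ true f101.
have f010 : fixed_near f (mk3 a1 false true false) := s3 _ _ _ _ f011.
have f100 : fixed_near f (mk3 a1 true false false) := s1 _ false f010.
have f001 : fixed_near f (mk3 a1 false false true) := s2 _ false f010.
have f000 : fixed_near f (mk3 a1 false false false) := s3 _ _ _ _ f001.
have f110 : fixed_near f (mk3 a1 true true false) := s2 _ true f101.
have f111 : fixed_near f (mk3 a1 true true true) := s3 _ _ _ _ f110.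
move=> v hv; rewrite (mk3E v) hv.
by case: (bit v 1) (bit v 2) (bit v 3) => -[] [].
Qed.

Lemma rigid3 (f : {perm T}) : 1 < n -> f \in yoke_aut n m ->
  fixed_near f zero_vertex -> f = 1%g.
Proof.
move=> n1 hf fz.
(* Each round lowers the bucket by one: starting from 0 it takes the values [n.-1], [n.-1 - 1], ...,
   0. *)
suff all_fixed k v : hd v = n.-1 - k :> nat -> fixed_near f v.
  apply/permP => v; rewrite perm1; case: (all_fixed (n.-1 - hd v) v) => //.
  by have := ltn_ord (hd v); lia.
elim: k v => [|k IH] v hv.
  apply: (@fixed_near3_up f (Ordinal n_gt0)) => //; last first.
    by apply: val_inj; rewrite /= hv /step /= pred_modE // subn0.
  suff <- : zero_vertex = mk3 (Ordinal n_gt0) false false false by [].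
  by apply: bit3_ext; rewrite ?bit_zero ?bit_make ?m3.
(* For [k >= n.-1] the truncated differences at [k] and [k.+1] are both 0. *)
have [kn|nk] := ltnP k n.-1; last by apply: IH; rewrite hv; lia.
have hn : n.-1 - k < n by lia.
apply: (@fixed_near3_up f (Ordinal hn)) => //; first by apply: IH.
by apply: val_inj; rewrite /= hv /step /= pred_modE //; case: ifP; lia.
Qed.
End Three.

(** At the zero vertex only the moves 0 and [m] are possible; a bit change in the image would add a
    third one and raise the degree. *)
Lemma aut_zero_flat (f : {perm T}) i : f \in yoke_aut n m -> 0 < i < m ->
  bit (f zero_vertex) i = bit (f zero_vertex) i.+1.
Proof.
move=> hf /andP[i0 im]; apply/eqP; apply: contraT => hi.
have m1 : 1 < m by lia.
have := degree_aut zero_vertex hf; rewrite !degreeE // => e.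
have le2 : #|[set k : 'I_m.+1 | movable zero_vertex k]| <= 2.
  apply: leq_trans (subset_leq_card (_ : _ \subset [set ord0; ord_max])) _.
    apply/subsetP => k; rewrite !inE /movable -!val_eqE /=.
    case: eqP => //= k0; case: eqP => //= km.
    by rewrite !bit_zero //; have := ltn_ord k; lia.
  by rewrite cards2; case: eqP.
have : 3 <= #|[set k : 'I_m.+1 | movable (f zero_vertex) k]|.
  have im1 : i < m.+1 by lia.
  have -> : 3 = #|[set ord0; ord_max; Ordinal im1]|.
    rewrite setUC cardsU1 cards2 !inE -!val_eqE /=.
    have -> : (i == 0) = false by lia.
    have -> : (i == m) = false by lia.
    by have -> : (0 == m) = false by lia.
  apply: subset_leq_card; apply/subsetP => k; rewrite !inE -!val_eqE /=.
  rewrite /movable => /orP[/orP[]|] /eqP ->; rewrite ?eqxx ?orbT //.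
  by rewrite hi !orbT.
by rewrite e; lia.
Qed.

Lemma aut_zero_back (f : {perm T}) : f \in yoke_aut n m ->
  exists2 g, g \in yoke_A n m & (f * g)%g zero_vertex = zero_vertex.
Proof.
move=> hf; have flat j : 0 < j <= m ->
    bit (f zero_vertex) j = bit (f zero_vertex) 1.
  elim: j => // -[_ //|j] IH hj; rewrite -aut_zero_flat //.
  by apply: IH; lia.
case b1: (bit (f zero_vertex) 1); last first.
  have [|g gA gz] := @zero_of_bits (f zero_vertex); last first.
    by exists g => //; rewrite permM.
  by move=> j /flat ->.
(* When all the bits are 1, [ptau] complements them first. *)
have [|g gA gz] := @zero_of_bits (ptau (f zero_vertex)).
  move=> j hj; rewrite permE /bit /= (nth_map false) ?size_tuple; last lia.
  by rewrite -/(bit _ j) flat // b1.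
exists (ptau * g)%g; last by rewrite !permM.
by rewrite groupM ?ptau_A.
Qed.

Lemma zero_neighbours u :
  yoke_adj u zero_vertex <->
  u = mv zero_vertex 0 \/ u = ppsi (mv zero_vertex 0).
Proof.
(* Reversal exchanges the two extreme moves, the only possible ones here. *)
have -> : ppsi (mv zero_vertex 0) = mv zero_vertex m.
  apply: vertex_ext => [|j hj]; last first.
    by rewrite bit_psi // !bit_mv ?bit_zero //; lia.
  rewrite hd_mv; have -> : (m == 0) = false by lia.
  have -> : hd (ppsi (mv zero_vertex 0)) = tl (mv zero_vertex 0).
    by rewrite permE.
  by rewrite tl_mv_inner //; exact/val_inj/tl_zero.
split=> [/adjP[] i [im mi ->]|].
  move: mi; rewrite /movable => /or3P[/eqP->|/eqP->|]; [by left | by right |].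
  have [/eqP->|i0] := boolP (i == 0); first by left.
  have [/eqP->|im'] := boolP (i == m); first by right.
  by rewrite !bit_zero //; lia.
by case=> ->; apply: adj_mv; rewrite // /movable eqxx ?orbT.
Qed.

Lemma aut_sub_A : m != 2 -> (n, m) != (1, 3) -> yoke_aut n m \subset yoke_A n m.
Proof.
rewrite xpair_eqE => m2 nm; apply/subsetP => f hf; apply: fixed_near_zeroP (hf).
- move=> h; have [hm|hm] := boolP ((m == 1) || (3 < m)).
    exact: rigid_generic.
  have m3 : m = 3 by lia.
  have n1 : 1 < n by lia.
  exact: (rigid3 m3 n1).
- exact: aut_zero_back.
by exists (mv zero_vertex 0); apply: zero_neighbours.
Qed.
End Moves.
End Yoke.

(** * The cycles m = 0 *)

Section Cycle.
Variable n : nat.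
Hypothesis n_gt0 : 0 < n.
Local Notation T := (yoke_vertex n 0).
Local Notation phi := (vphi n_gt0).
Local Notation z := (zero_vertex 0 n_gt0).

Lemma cycle_ext (u v : T) : hd u = hd v -> u = v.
Proof. by move=> e; apply: (vertex_ext n_gt0) => // -[]. Qed.

(** The single move changes both buckets, as [phi] or its inverse does. *)
Lemma cycle_adjP (u v : T) : reflect (u = phi v \/ v = phi u) (yoke_adj u v).
Proof.
have key (x y : T) : ymove (val x) (val y) 0 -> x = phi y.
  by case/andP=> /eqP h _; apply: cycle_ext; apply: val_inj.
have adj (x : T) : ymove (val (phi x)) (val x) 0.
  apply/andP; split; first exact: eqxx.
  by rewrite /ysucc /ybucket /= /ycoord /= (succ_step_false n_gt0 (tl x)).
apply: (iffP existsP) => [[[[|//] i0] /andP[_ /orP[]/key]]|h].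
- by left.
- by right.
exists ord0; apply/andP; split; first by apply/forallP => -[[|[|]]].
by case: h => ->; rewrite adj ?orbT.
Qed.

Lemma cycle_rigid (f : {perm T}) :
  f \in yoke_aut n 0 -> fixed_near f z -> f = 1%g.
Proof.
move=> /yoke_autP hf fz.
have step v : fixed_near f v -> fixed_near f (phi v).
  case=> fv fN; have fw : f (phi v) = phi v by apply/fN/cycle_adjP; left.
  split=> // u /cycle_adjP[eu|/vphi_inj <- //].
  have : yoke_adj (f u) (phi v) by rewrite -fw hf; apply/cycle_adjP; left.
  case/cycle_adjP => [->|/vphi_inj e]; first by rewrite eu.
  have -> // : u = v by apply: (@perm_inj _ f); rewrite -e fv.
suff all_fixed k (v : T) : hd v = k :> nat -> fixed_near f v.
  by apply/permP => v; rewrite perm1; case: (all_fixed _ v erefl).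
elim: k v => [|k IH] v hv.
  by suff -> : v = z by []; apply: cycle_ext; apply: val_inj.
have kn : k < n by rewrite ltnW // -hv.
suff -> : v = phi (@make_vertex n 0 n_gt0 (Ordinal kn) xpred0) by apply/step/IH.
apply: cycle_ext; apply: val_inj; apply: (etrans hv).
by rewrite /= succ_modE // ltn_eqF // -hv.
Qed.

Lemma cycle_aut_sub_A : yoke_aut n 0 \subset yoke_A n 0.
Proof.
apply/subsetP => f hf; apply: (fixed_near_zeroP (n_gt0 := n_gt0)) (hf).
- exact: cycle_rigid.
- have [|g gA gz] := @zero_of_bits n 0 n_gt0 (f z); first by case.
  by exists g => //; rewrite permM.
exists (phi z) => u.
(* Conjugation by [psi] inverts [phi], and [psi] fixes [z]: so [psi (phi z)] is the other neighbour
   of [z]. *)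
have phipsi : phi (ppsi 0 n_gt0 (phi z)) = z.
  rewrite -[RHS]psi_zero; apply: cycle_ext; apply: val_inj; rewrite !permE.
  exact: (succ_step_false n_gt0 (tl z)).
have zE : z = phi u <-> u = ppsi 0 n_gt0 (phi z).
  split=> [e|->]; last by rewrite phipsi.
  by apply: (@vphi_inj n 0 n_gt0); rewrite phipsi.
split=> [/cycle_adjP[->|/zE ->]|]; [by left | by right |].
by case=> [->|/zE e]; apply/cycle_adjP; [left | right].
Qed.
End Cycle.

(** * The exceptional graph n = 1, m = 3 *)

(** By the dihedral presentation [D = <x, y>] is an image of ['D_8], and it has order 8. The
    involution [c] centralises [D] and lies outside it, so [D \x <[c]>] has order 16 and fills
    [G]. *)
Lemma dihedral8_dprod_isog (gT : finGroupType) (G : {group gT}) (x y c : gT) :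
    x \in G -> y \in G -> c \in G -> #|G| <= 16 ->
    (x ^+ 4 = 1)%g -> (y ^+ 2 = 1)%g -> (x ^ y = x^-1)%g -> (c ^+ 2 = 1)%g ->
    (x ^+ 2 != 1)%g -> commute x c -> commute y c ->
    c \notin (<[x]> <*> <[y]>)%g ->
  G \isog [set: ('D_8 * 'Z_2)%type].
Proof.
move=> xG yG cG oG x4 y2 xy c2 nx2 cx cy ncD.
(* Otherwise [y] commutes with [x], which it inverts, and [x ^+ 2 = 1]. *)
have nyx : y \notin <[x]>%g.
  apply: contra nx2 => /cycleP[k ey].
  have cxy : commute x y by rewrite ey; apply: commuteX.
  have xV : (x^-1 = x)%g by rewrite -xy conjgE cxy mulKg.
  by rewrite expgS expg1 -{1}xV mulVg.
pose D := (<[x]> <*> <[y]>)%G.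
have hD : (D \homg [set: 'D_8])%g.
  rewrite -[8]/(4.*2) Grp_dihedral //; apply/existsP; exists (x, y).
  by rewrite /= !xpair_eqE x4 y2 xy !eqxx.
have c8 : #|[set: 'D_8]%g| = 8 := @card_dihedral 4 isT.
have ox : #[x]%g = 4.
  have /(dvdn_pfactor _ 2 (isT : prime 2)) : #[x]%g %| 2 ^ 2.
    by rewrite order_dvdn x4.
  by case=> -[|[|[|k]]] // _ e; case/negP: nx2; rewrite -order_dvdn e.
have oD : #|D| = 8.
  have d8 : #|D| %| 8 by rewrite -c8; apply: card_homg.
  have d4 : 4 %| #|D| by rewrite -ox orderE cardSg ?joing_subl.
  have n4 : #|D| != 4.
    apply: contra nyx => /eqP e; have -> : <[x]>%g = D.
      by apply/eqP; rewrite eqEcard joing_subl e -orderE ox.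
    by rewrite -cycle_subG joing_subr.
  have : #|D| <= 8 by apply: dvdn_leq.
  by move: (#|D|) d8 d4 n4 => [|[|[|[|[|[|[|[|[|?]]]]]]]]].
have iD : (D \isog [set: 'D_8])%g by rewrite isogEcard hD c8 oD.
have oc : #[c]%g = 2.
  apply: nt_prime_order => //; apply: contra ncD => /eqP ->; exact: group1.
have iC : (<[c]> \isog [set: 'Z_2])%g.
  rewrite isog_cyclic_card ?cycle_cyclic // -orderE oc cardsT card_ord eqxx.
  rewrite andbT.
  by apply: prime_cyclic; rewrite cardsT card_ord.
have ti : (D :&: <[c]> = 1)%g.
  by rewrite setIC prime_TIg ?cycle_subG // -orderE oc.
have cDC : (<[c]> \subset 'C(D))%g.
  rewrite cycle_subG /= centY inE !cent_cycle; apply/andP.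
  by split; apply/cent1P.
have dG : (D \x <[c]> = G)%g.
  rewrite dprodE //; apply/eqP; rewrite eqEcard TI_cardMg // oD -orderE oc oG.
  by rewrite andbT mul_subG ?join_subG ?cycle_subG ?xG ?yG.
have dL := setX_dprod [set: 'D_8]%G [set: 'Z_2]%G.
have -> : [set: 'D_8 * 'Z_2] = setX [set: 'D_8] [set: 'Z_2].
  by apply/setP => p; rewrite !inE.
apply: (isog_dprod dG dL).
  exact: isog_trans iD (isog_setX1 _ _).
exact: isog_trans iC (isog_set1X _ _).
Qed.

Section Exception.
Local Notation T := (yoke_vertex 1 3).
Local Notation code := (bool * bool * bool)%type.

(** For [n = 1] the buckets carry no information; on bit triples adjacency can be evaluated. *)
Definition decode (b : code) : T := mk3 3 (ltn0Sn 0) ord0 b.1.1 b.1.2 b.2.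
Definition encode (v : T) : code := (bit v 1, bit v 2, bit v 3).

Lemma decodeK : cancel decode encode.
Proof. by move=> [[a b] c]; rewrite /encode !bit_make. Qed.

Lemma encodeK : cancel encode decode.
Proof.
by move=> v; rewrite [RHS](mk3E (ltn0Sn 0) (ltn0Sn 2) erefl) [hd v]ord1.
Qed.

(** The disjuncts are the moves 0 to 3; flipping two distinct bits is exchanging them. *)
Definition code_adj (u v : code) : bool :=
  let: (a, b, c) := v in
  [|| u == (~~ a, b, c), (a != b) && (u == (b, a, c)),
      (b != c) && (u == (a, c, b)) | u == (a, b, ~~ c)].

Lemma decode_adj u v : yoke_adj (decode u) (decode v) = code_adj u v.
Proof.
case: v => [[a b] c]; have [e0 e1 e2 e3] := mv3 (ltn0Sn 0) (erefl 3) ord0 a b c.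
have mE : decode (a, b, c) = mk3 3 (ltn0Sn 0) ord0 a b c by [].
have nE (x y z : bool) o : mk3 3 (ltn0Sn 0) o x y z = decode (x, y, z).
  by congr mk3; rewrite (ord1 o).
rewrite !nE in e0 e1 e2 e3.
have dE w : (decode u = decode w) <-> (u == w).
  by split=> [/(can_inj decodeK) -> | /eqP ->].
apply/(adjP (ltn0Sn 0) (ltn0Sn 2))/or4P => [[i [im]]|].
  rewrite /movable; case: i im => [|[|[|[|i]]]] // _.
  - move=> _; rewrite e0 => /dE h; exact: Or41.
  - rewrite !bit_make //= => ab; rewrite e1 => /dE h; apply: Or42; rewrite ab.
    by case: (a) (b) ab h => -[].
  - rewrite !bit_make //= => bc; rewrite e2 => /dE h; apply: Or43; rewrite bc.
    by case: (b) (c) bc h => -[].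
  by move=> _; rewrite e3 => /dE; apply: Or44.
case=> [h|/andP[ab h]|/andP[bc h]|h].
- by exists 0; split=> //; rewrite e0; apply/dE.
- exists 1; split=> //; first by rewrite /movable !bit_make.
  by rewrite e1; apply/dE; case: (a) (b) ab h => -[].
- exists 2; split=> //; first by rewrite /movable !bit_make.
  by rewrite e2; apply/dE; case: (b) (c) bc h => -[].
by exists 3; split=> //; rewrite e3; apply/dE.
Qed.

Definition codes : seq code :=
  [seq (ab, c) | ab <- [seq (a, b) | a <- [:: false; true],
                                     b <- [:: false; true]],
                 c <- [:: false; true]].

Lemma mem_codes c : c \in codes.
Proof. by case: c => -[[] []] []. Qed.

(** [l] holds the images already chosen for the first [k] codes. *)
Definition next_images (k : nat) (l : seq code) : seq code :=
  [seq c <- codes | (c \notin l) &&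
    all (fun i => code_adj (nth c l i) c ==
                  code_adj (nth c codes i) (nth c codes k)) (iota 0 k)].

(* Backtracking search for the images of the first [k] codes. *)
Fixpoint partial_auts (k : nat) : seq (seq code) :=
  if k is k'.+1 then
    [seq rcons l c | l <- partial_auts k', c <- next_images k' l]
  else [:: [::]].

Lemma size_partial_auts : size (partial_auts 8) = 16.
Proof. by vm_compute. Qed.

Lemma mem_partial_auts (g : code -> code) k : injective g ->
    (forall u v, code_adj (g u) (g v) = code_adj u v) -> k <= 8 ->
  map g (take k codes) \in partial_auts k.
Proof.
move=> gi ga; elim: k => [|k IH] k8 //.
have sk : k < size codes by [].
have c0 : code := (false, false, false).
rewrite (take_nth c0) // map_rcons; apply/allpairsPdep.
exists (map g (take k codes)), (g (nth c0 codes k)); split=> //.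
  exact/IH/ltnW.
rewrite mem_filter mem_codes andbT; apply/andP; split.
  rewrite mem_map //; have : uniq (take k.+1 codes) by rewrite take_uniq.
  by rewrite (take_nth c0) // rcons_uniq => /andP[].
apply/allP => i; rewrite mem_iota /= add0n => ik.
have si : i < size codes by apply: ltn_trans sk.
rewrite (nth_map c0) ?size_takel ?(ltnW sk) // ga nth_take //.
(* The search uses the candidate itself as default value; the indices are in range, so any default
   will do. *)
by rewrite (set_nth_default c0 _ si) (set_nth_default c0 _ sk).
Qed.

(** The table of an automorphism on [codes] determines it and is among the results of the search. *)
Lemma card_aut13 : #|yoke_aut 1 3| <= 16.
Proof.
pose F (f : {perm T}) := [seq encode (f (decode c)) | c <- codes].
rewrite cardE -(size_map F) -size_partial_auts; apply: uniq_leq_size.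
  rewrite map_inj_uniq ?enum_uniq // => f g /eq_in_map e.
  apply/permP => v; apply: (can_inj encodeK).
  by have := e (encode v) (mem_codes _); rewrite !encodeK.
move=> l /mapP[f]; rewrite mem_enum => /yoke_autP hf ->.
apply: (@mem_partial_auts (fun c => encode (f (decode c))) 8) => //.
  by move=> u v /(can_inj encodeK)/perm_inj/(can_inj decodeK).
by move=> u v; rewrite -!decode_adj !encodeK hf.
Qed.

Definition code_perm (F : code -> code) (FK : involutive F) : {perm T} :=
  perm (can_inj (f := decode \o F \o encode) (g := decode \o F \o encode)
    (fun v => etrans (congr1 (decode \o F) (decodeK _))
       (etrans (congr1 decode (FK _)) (encodeK v)))).

Lemma code_permE F (FK : involutive F) c :
  code_perm FK (decode c) = decode (F c).
Proof. by rewrite permE /= decodeK. Qed.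

Lemma code_perm_aut F (FK : involutive F) :
  all (fun u => all (fun v => code_adj (F u) (F v) == code_adj u v) codes)
    codes ->
  code_perm FK \in yoke_aut 1 3.
Proof.
move=> /allP h; apply/yoke_autP => u v.
rewrite -[u]encodeK -[v]encodeK !code_permE !decode_adj.
by apply/eqP; move/allP: (h _ (mem_codes (encode u))); apply; apply: mem_codes.
Qed.

(* The graph is the chain of layers {000}, {001,100}, {010,101}, {011,110},
   {111}, consecutive layers being completely joined. *)
Definition swap_low (u : code) : code :=
  let: (a, b, c) := u in if b then u else (c, b, a).
Definition swap_mid (u : code) : code :=
  let: (a, b, c) := u in if (a == c) && (a != b) then (~~ a, ~~ b, ~~ c) else u.
Definition flip_layers (u : code) : code :=
  let: (a, b, c) := u in
  if a != c then (a, ~~ b, c) else if a == b then (~~ a, ~~ b, ~~ c) else u.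

Fact swap_lowK : involutive swap_low. Proof. by case=> [[[] []] []]. Qed.
Fact swap_midK : involutive swap_mid. Proof. by case=> [[[] []] []]. Qed.
Fact flip_layersK : involutive flip_layers. Proof. by case=> [[[] []] []]. Qed.

Lemma perm_codeP (f g : {perm T}) :
  (forall c, f (decode c) = g (decode c)) -> f = g.
Proof. by move=> h; apply/permP => v; rewrite -[v]encodeK. Qed.

(** [x] permutes 001, 110, 100, 011 in a 4-cycle and [y] inverts it, while [c] only exchanges 010
    and 101. *)
Lemma aut13_isog : yoke_aut 1 3 \isog [set: ('D_8 * 'Z_2)%type].
Proof.
pose s := code_perm swap_lowK; pose y := code_perm flip_layersK.
pose c := code_perm swap_midK; pose x := (s * y)%g.
have sG : s \in yoke_aut 1 3 by apply: code_perm_aut; vm_compute.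
have yG : y \in yoke_aut 1 3 by apply: code_perm_aut; vm_compute.
have cG : c \in yoke_aut 1 3 by apply: code_perm_aut; vm_compute.
have E : forall F (FK : involutive F), (code_perm FK * code_perm FK = 1)%g.
  by move=> F FK; apply: perm_codeP => u; rewrite permM !code_permE FK perm1.
have ss : (s * s = 1)%g by apply: E.
have yy : (y * y = 1)%g by apply: E.
have yV : (y^-1 = y)%g by apply/eqP; rewrite eq_invg_mul yy.
have sV : (s^-1 = s)%g by apply/eqP; rewrite eq_invg_mul ss.
have x2 u : (x ^+ 2)%g (decode u) =
    decode (flip_layers (swap_low (flip_layers (swap_low u)))).
  by rewrite expgS expg1 !permM !code_permE.
(* [x] and [y] both fix 010, which [c] moves; this separates [c] from the dihedral factor. *)
have Dmid : forall g, g \in (<[x]> <*> <[y]>)%g ->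
    g (decode (false, true, false)) = decode (false, true, false).
  have sub : (<[x]> <*> <[y]> \subset 'C[decode (false, true, false) | 'P])%g.
    rewrite join_subG !cycle_subG; apply/andP.
    by split; apply/astab1P; rewrite /= /aperm ?permM !code_permE.
  by move=> g /(subsetP sub)/astab1P.
apply: (@dihedral8_dprod_isog _ [group of yoke_aut 1 3] x y c) => //.
- by rewrite groupM.
- exact: card_aut13.
- apply: perm_codeP => u; rewrite (expgM x 2 2) expgS expg1 permM !x2 perm1.
  by case: u => [[[] []] []].
- by rewrite conjgE yV /x invMg yV sV -!mulgA yy mulg1.
- exact: E.
- apply/eqP => /permP/(_ (decode (false, false, true))); rewrite x2 perm1.
  by move/(can_inj decodeK).
- apply: perm_codeP => u; rewrite !permM !code_permE.
  by case: u => [[[] []] []].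
- apply: perm_codeP => u; rewrite !permM !code_permE.
  by case: u => [[[] []] []].
by apply/negP => /Dmid; rewrite code_permE => /(can_inj decodeK).
Qed.
End Exception.

Theorem theorem6p13 :
  (yoke_aut 1 3 \isog [set: ('D_8 * 'Z_2)%type])
  /\
  (forall n m : nat, 1 <= n -> m != 2 -> (n, m) != (1, 3) ->
     yoke_aut n m \isog yoke_A n m).
Proof.
split=> [|n m n_gt0 m2 nm]; first exact: aut13_isog.
suff -> : yoke_aut n m = yoke_A n m by exact: (isog_refl <<_>>%G).
apply/eqP; rewrite eqEsubset yoke_A_sub // andbT.
case: m m2 nm => [|m] m2 nm; first exact: cycle_aut_sub_A.
exact: (aut_sub_A n_gt0 (ltn0Sn m)).
Qed.
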